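(* $$\frac{2\pi}{\sqrt{3}} = \sum_{k=0}^{\infty}\left(\frac14\right)^{k}\frac{\left(\frac13\right)_k}{\left(\frac76\right)_k}\cdot\frac{9k+7}{(k+1)(3k+2)}.$$
   Context: For $k\in\mathbb{N}_0$, $(\alpha)_k=\alpha(\alpha+1)\cdots(\alpha+k-1)$ is the rising factorial (Pochhammer symbol), with $(\alpha)_0=1$. *)

(* Defs.v *)
From Stdlib Require Import Reals.
Open Scope R_scope.

(** Rising factorial [(a)_k = a (a + 1) ... (a + k - 1)], with [(a)_0 = 1]. *)
Fixpoint pochhammer (a : R) (k : nat) : R :=
  match k with
  | O => 1
  | S j => pochhammer a j * (a + INR j)
  end.

(* Main.v *)
Require Import Defs.
From Stdlib Require Import Reals Lra Lia.
From Coquelicot Require Import Coquelicot.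
Open Scope R_scope.

(** Wilf-Zeilberger acceleration of
    [2 PI / sqrt 3 = sum_n 6 / ((3 n + 1) (3 n + 2))]: with
    [F n k = 2 (1/3)_(n+k) (2/3)_k / ((4/3)_(n+2k) (n + k + 2/3))] there is a
    rational multiple [G] of [F] with
    [F n (k+1) - F n k = G (n+1) k - G n k].  Summing over a square identifies
    [sum_k G 0 k], the series of the theorem, with [sum_n F n 0], since the two
    other sides of the square vanish in the limit.  The sum of [F n 0] is found
    by integrating [1 / (1 + x + x^2) = sum_n (x^(3n) - x^(3n+1))] from 0 to 1. *)

(** * Telescoping over a rectangle *)

(** Summing the relation over [n] collapses its [G] side ([column]); summing that over [k] collapses
    the [F] side. The right-hand side collects the two far sides of the rectangle. *)
Lemma wz_square (F G : nat -> nat -> R) :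
  (forall n k, F n (S k) - F n k = G (S n) k - G n k) ->
  forall N K,
    sum_n (G 0%nat) K - sum_n (fun n => F n 0%nat) N
    = sum_n (G (S N)) K - sum_n (fun n => F n (S K)) N.
Proof.
intros wz.
assert (column : forall N k,
  sum_n (fun n => F n (S k)) N - sum_n (fun n => F n k) N
  = G (S N) k - G 0%nat k).
{ intros N k; induction N as [|N IH].
  - rewrite !sum_O; apply wz.
  - rewrite !sum_Sn; unfold plus; simpl.
    specialize (wz (S N) k); lra. }
intros N K; induction K as [|K IH].
- rewrite !sum_O; specialize (column N 0%nat); lra.
- rewrite !sum_Sn; unfold plus; simpl.
  specialize (column N (S K)); lra.
Qed.

(** * The WZ pair: shifts, boundary values and bounds *)

Lemma pochhammer_pos (a : R) (k : nat) : 0 < a -> 0 < pochhammer a k.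
Proof.
intros Ha; induction k as [|k IH]; simpl; [lra|].
pose proof (pos_INR k); apply Rmult_lt_0_compat; lra.
Qed.

(** Split off from [wz_F] because both shifts multiply it by a simple rational function, which
    reduces the WZ relation to [field]. *)
Definition wz_u (n k : nat) : R :=
  pochhammer (1 / 3) (n + k) * pochhammer (2 / 3) k
  / pochhammer (4 / 3) (n + 2 * k).

Definition wz_F (n k : nat) : R := 2 * wz_u n k / (INR n + INR k + 2 / 3).

Definition wz_G (n k : nat) : R :=
  wz_F n k
  * ((INR n ^ 2 + (3 * INR k + 2) * INR n
      + (9 * INR k + 7) * (3 * INR k + 2) / 9)
     / ((INR k + 1) * (INR n + 2 * INR k + 4 / 3))).

Lemma wz_u_pos (n k : nat) : 0 < wz_u n k.
Proof.
unfold wz_u; apply Rdiv_lt_0_compat; [apply Rmult_lt_0_compat|];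
  apply pochhammer_pos; lra.
Qed.

Lemma wz_u_succ_l (n k : nat) :
  wz_u (S n) k
  = wz_u n k * ((INR n + INR k + 1 / 3) / (INR n + 2 * INR k + 4 / 3)).
Proof.
unfold wz_u; cbn [Nat.add pochhammer].
pose proof (pochhammer_pos (4 / 3) (n + 2 * k) ltac:(lra)).
pose proof (pos_INR n); pose proof (pos_INR k).
rewrite !plus_INR, mult_INR; simpl (INR 2).
field; lra.
Qed.

Lemma wz_u_succ_r (n k : nat) :
  wz_u n (S k)
  = wz_u n k
    * ((INR n + INR k + 1 / 3) * (INR k + 2 / 3)
       / ((INR n + 2 * INR k + 4 / 3) * (INR n + 2 * INR k + 7 / 3))).
Proof.
unfold wz_u.
replace (n + S k)%nat with (S (n + k)) by lia.
replace (n + 2 * S k)%nat with (S (S (n + 2 * k))) by lia.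
cbn [pochhammer].
pose proof (pochhammer_pos (4 / 3) (n + 2 * k) ltac:(lra)).
pose proof (pos_INR n); pose proof (pos_INR k).
rewrite S_INR, !plus_INR, mult_INR; simpl (INR 2).
field; lra.
Qed.

(** The quotient (1/3)_n / (4/3)_n telescopes to (1/3) / (n + 1/3). *)
Lemma wz_u_0_r (n : nat) : wz_u n 0 = 1 / (3 * INR n + 1).
Proof.
induction n as [|n IH].
- unfold wz_u; simpl; field.
- rewrite wz_u_succ_l, IH, S_INR; simpl (INR 0).
  pose proof (pos_INR n); field; lra.
Qed.

(** By duplication, (4/3)_(2k) = 4^k (2/3)_k (7/6)_k; this is the origin of 1/4 and 7/6 in the
    series. *)
Lemma wz_u_0_l (k : nat) :
  wz_u 0 k = (1 / 4) ^ k * (pochhammer (1 / 3) k / pochhammer (7 / 6) k).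
Proof.
induction k as [|k IH].
- unfold wz_u; simpl; field.
- rewrite wz_u_succ_r, IH; simpl.
  pose proof (pochhammer_pos (7 / 6) k ltac:(lra)).
  pose proof (pos_INR k); field; lra.
Qed.

(** Each shift in [k] at least halves [wz_u]: (n+k+1/3)/(n+2k+4/3) <= 1 and (k+2/3)/(n+2k+7/3) <=
    1/2. *)
Lemma wz_u_le (n k : nat) : wz_u n k <= (1 / 2) ^ k / (3 * INR n + 1).
Proof.
pose proof (pos_INR n).
induction k as [|k IH].
- rewrite wz_u_0_r; simpl; lra.
- pose proof (pos_INR k); rewrite wz_u_succ_r.
  replace ((1 / 2) ^ S k / (3 * INR n + 1))
    with ((1 / 2) ^ k / (3 * INR n + 1) * (1 / 2)) by (simpl; field; lra).
  apply Rmult_le_compat; [left; apply wz_u_pos | | exact IH | ].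
  + left; apply Rdiv_lt_0_compat; apply Rmult_lt_0_compat; lra.
  + apply Rle_div_l; [apply Rmult_lt_0_compat; lra | nra].
Qed.

Lemma wz_equation (n k : nat) :
  wz_F n (S k) - wz_F n k = wz_G (S n) k - wz_G n k.
Proof.
unfold wz_G, wz_F; rewrite wz_u_succ_l, wz_u_succ_r, !S_INR.
pose proof (pos_INR n); pose proof (pos_INR k).
field; lra.
Qed.

Lemma wz_F_pos (n k : nat) : 0 < wz_F n k.
Proof.
pose proof (pos_INR n); pose proof (pos_INR k); pose proof (wz_u_pos n k).
apply Rdiv_lt_0_compat; lra.
Qed.

Lemma wz_F_0_r (n : nat) :
  wz_F n 0 = 6 * (1 / (3 * INR n + 1) - 1 / (3 * INR n + 2)).
Proof.
unfold wz_F; rewrite wz_u_0_r; simpl (INR 0).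
pose proof (pos_INR n); field; lra.
Qed.

Lemma wz_F_le (n k : nat) : wz_F n k <= 2 * (1 / 2) ^ k / (INR k + 2 / 3).
Proof.
pose proof (pos_INR n); pose proof (pos_INR k).
assert (Hp : 0 < (1 / 2) ^ k) by (apply pow_lt; lra).
assert (Hu : wz_u n k <= (1 / 2) ^ k).
{ eapply Rle_trans; [apply wz_u_le|]. apply Rle_div_l; nra. }
pose proof (wz_u_pos n k).
unfold wz_F, Rdiv; apply Rmult_le_compat; try lra.
- left; apply Rinv_0_lt_compat; lra.
- apply Rinv_le_contravar; lra.
Qed.

Lemma wz_G_pos (n k : nat) : 0 < wz_G n k.
Proof.
pose proof (pos_INR n); pose proof (pos_INR k).
apply Rmult_lt_0_compat; [apply wz_F_pos|].
apply Rdiv_lt_0_compat; nra.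
Qed.

Lemma wz_G_le (n k : nat) : wz_G n k <= 4 / (3 * INR n + 1) * (1 / 2) ^ k.
Proof.
pose proof (pos_INR n); pose proof (pos_INR k); pose proof (wz_u_pos n k).
apply Rle_trans with (4 * wz_u n k).
- unfold wz_G, wz_F.
  replace (4 * wz_u n k)
    with (2 * wz_u n k / (INR n + INR k + 2 / 3)
          * (2 * (INR n + INR k + 2 / 3))) by (field; lra).
  apply Rmult_le_compat_l; [left; apply wz_F_pos|].
  apply Rle_div_l; [apply Rmult_lt_0_compat; lra|].
  (* With denominators cleared, the difference of the two sides is a cubic in n and k with
     nonnegative coefficients; these are its mixed and cubic monomials. *)
  assert (0 <= INR n * INR k) by nra.
  assert (0 <= INR n * INR k * INR k) by nra.
  assert (0 <= INR n * INR n * INR k) by nra.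
  assert (0 <= INR k * INR k * INR k) by nra.
  nra.
- pose proof (wz_u_le n k).
  replace (4 / (3 * INR n + 1) * (1 / 2) ^ k)
    with (4 * ((1 / 2) ^ k / (3 * INR n + 1))) by (field; lra).
  lra.
Qed.

Lemma wz_G_0_l (k : nat) :
  wz_G 0 k
  = (1 / 4) ^ k
    * (pochhammer (1 / 3) k / pochhammer (7 / 6) k)
    * ((9 * INR k + 7) / ((INR k + 1) * (3 * INR k + 2))).
Proof.
rewrite <- wz_u_0_l; unfold wz_G, wz_F; simpl (INR 0).
pose proof (pos_INR k); field; lra.
Qed.

(** * Decay of the far sides of the square *)

Lemma wz_F_sum_le (N k : nat) :
  sum_n (fun n => wz_F n k) N
  <= (INR N + 1) * (2 * (1 / 2) ^ k / (INR k + 2 / 3)).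
Proof.
induction N as [|N IH].
- rewrite sum_O; simpl (INR 0); pose proof (wz_F_le 0 k); lra.
- rewrite sum_Sn, S_INR; unfold plus; simpl.
  pose proof (wz_F_le (S N) k); lra.
Qed.

Lemma wz_G_sum_le (n K : nat) : sum_n (wz_G n) K <= 8 / (3 * INR n + 1).
Proof.
pose proof (pos_INR n).
assert (Hc : 0 < 4 / (3 * INR n + 1)) by (apply Rdiv_lt_0_compat; lra).
(* The exact geometric sum 2 - 2^(-K) makes the induction go through; the bound 2 alone would
   not. *)
apply Rle_trans with (4 / (3 * INR n + 1) * (2 - (1 / 2) ^ K)).
- induction K as [|K IH].
  + rewrite sum_O; pose proof (wz_G_le n 0); simpl in *; lra.
  + rewrite sum_Sn; unfold plus; simpl.
    pose proof (wz_G_le n (S K)); simpl in *; lra.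
- assert (0 < (1 / 2) ^ K) by (apply pow_lt; lra).
  replace (8 / (3 * INR n + 1)) with (4 / (3 * INR n + 1) * 2) by (field; lra).
  apply Rmult_le_compat_l; lra.
Qed.

Lemma sum_n_pos (a : nat -> R) (N : nat) :
  (forall n, 0 < a n) -> 0 < sum_n a N.
Proof.
intros Ha; induction N as [|N IH].
- rewrite sum_O; apply Ha.
- rewrite sum_Sn; unfold plus; simpl; specialize (Ha (S N)); lra.
Qed.

(** On the square N = K the far [G] side contributes at most 8/(K+1) and the far [F] side at most
    2/(K+1), whence 10. *)
Lemma wz_sums_close (K : nat) :
  Rabs (sum_n (wz_G 0) K - sum_n (fun n => wz_F n 0) K)
  <= 10 / (INR K + 1).
Proof.
rewrite (wz_square wz_F wz_G wz_equation K K).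
pose proof (pos_INR K).
pose proof (sum_n_pos (wz_G (S K)) K (wz_G_pos (S K))).
pose proof (sum_n_pos (fun n => wz_F n (S K)) K (fun n => wz_F_pos n (S K))).
pose proof (wz_G_sum_le (S K) K) as HG.
pose proof (wz_F_sum_le K (S K)) as HF.
rewrite S_INR in HG, HF.
assert (Hpow : (1 / 2) ^ S K <= 1 / (INR K + 1)).
{ clear; induction K as [|K IH]; [simpl; lra|].
  rewrite S_INR; pose proof (pos_INR K).
  apply Rle_trans with (1 / 2 * (1 / (INR K + 1))).
  - change ((1 / 2) ^ S (S K)) with (1 / 2 * (1 / 2) ^ S K); lra.
  - replace (1 / 2 * (1 / (INR K + 1))) with (1 / (2 * INR K + 2))
      by (field; lra).
    apply Rmult_le_compat_l; [lra|]; apply Rinv_le_contravar; lra. }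
assert (8 / (3 * (INR K + 1) + 1) <= 8 / (INR K + 1)).
{ apply Rmult_le_compat_l; [lra|]; apply Rinv_le_contravar; lra. }
(* The denominator from [wz_F_le] absorbs the number K + 1 of summands. *)
assert ((INR K + 1) * (2 * (1 / 2) ^ S K / (INR K + 1 + 2 / 3))
        <= 2 * (1 / 2) ^ S K).
{ assert (0 < (1 / 2) ^ S K) by (apply pow_lt; lra).
  replace ((INR K + 1) * (2 * (1 / 2) ^ S K / (INR K + 1 + 2 / 3)))
    with ((INR K + 1) * (2 * (1 / 2) ^ S K) / (INR K + 1 + 2 / 3))
    by (field; lra).
  apply Rle_div_l; [lra|nra]. }
apply Rabs_le; lra.
Qed.

(** * The arctangent integral *)

(** Mean value theorem. It stands in for integration: integrals over [0,1] are compared through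
    increments of antiderivatives. *)
Lemma nonneg_derivative_le (f df : R -> R) :
  (forall x, 0 <= x <= 1 -> is_derive f x (df x)) ->
  (forall x, 0 <= x <= 1 -> 0 <= df x) ->
  f 0 <= f 1.
Proof.
intros Hd Hp.
destruct (MVT_gen f 0 1 df) as [c [Hc Heq]];
  rewrite ?Rmin_left, ?Rmax_right in * by lra.
- intros x Hx; apply Hd; lra.
- intros x Hx; apply continuity_pt_filterlim.
  apply (ex_derive_continuous f x); exists (df x); apply Hd; lra.
- specialize (Hp c Hc); lra.
Qed.

(** An antiderivative of 1/(1+x+x^2) minus one of its expansion truncated after the term n = N. *)
Definition atan_remainder (N : nat) (x : R) : R :=
  2 / sqrt 3 * atan ((2 * x + 1) / sqrt 3)
  - sum_n (fun n => x ^ (3 * n + 1) / (3 * INR n + 1)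
                    - x ^ (3 * n + 2) / (3 * INR n + 2)) N.

(** Since (1-x)(1+x+x^2) = 1-x^3, removing x^(3n)(1-x) from x^(3n)/(1+x+x^2) leaves
    x^(3n+3)/(1+x+x^2). *)
Lemma is_derive_atan_remainder (N : nat) (x : R) :
  is_derive (atan_remainder N) x (x ^ (3 * N + 3) / (1 + x + x ^ 2)).
Proof.
assert (Hq : 0 < 1 + x + x ^ 2) by nra.
assert (Hs : sqrt 3 * sqrt 3 = 3) by (apply sqrt_sqrt; lra).
assert (Hs0 : 0 < sqrt 3) by (apply sqrt_lt_R0; lra).
assert (Hterm : forall n, is_derive
  (fun x => x ^ (3 * n + 1) / (3 * INR n + 1)
            - x ^ (3 * n + 2) / (3 * INR n + 2))
  x (x ^ (3 * n) * (1 - x))).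
{ intros n; pose proof (pos_INR n).
  auto_derive; [exact I|].
  change (n + (n + (n + 0)))%nat with (3 * n)%nat.
  replace (Init.Nat.pred (3 * n + 1)) with (3 * n)%nat by lia.
  replace (Init.Nat.pred (3 * n + 2)) with (S (3 * n)) by lia.
  rewrite !plus_INR, mult_INR; simpl pow; simpl (INR 3); simpl (INR 2);
    simpl (INR 1).
  field; lra. }
induction N as [|N IH].
- apply is_derive_ext with (fun x =>
    2 / sqrt 3 * atan ((2 * x + 1) / sqrt 3)
    - (x ^ (3 * 0 + 1) / (3 * INR 0 + 1)
       - x ^ (3 * 0 + 2) / (3 * INR 0 + 2))).
  { intros t; unfold atan_remainder; rewrite sum_O; reflexivity. }
  replace (x ^ (3 * 0 + 3) / (1 + x + x ^ 2))
    with (1 / (1 + x + x ^ 2) - x ^ (3 * 0) * (1 - x)) by (simpl; field; lra).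
  apply @is_derive_minus; [|apply Hterm].
  auto_derive; [exact I|].
  (* Completing the square gives 1 + (2x+1)^2/3 = (4/3)(1+x+x^2); factors [sqrt 3] are paired so
     that [Hs] turns them into 3. *)
  assert (Hs2 : ((2 * x + 1) * / sqrt 3) ^ 2 = (2 * x + 1) ^ 2 / 3).
  { transitivity ((2 * x + 1) ^ 2 / (sqrt 3 * sqrt 3));
      [field; lra | now rewrite Hs]. }
  change ((2 * x + 1) * / sqrt 3 * ((2 * x + 1) * / sqrt 3 * 1))
    with (((2 * x + 1) * / sqrt 3) ^ 2).
  rewrite Hs2.
  transitivity (4 / (sqrt 3 * sqrt 3) / (1 + (2 * x + 1) ^ 2 / 3));
    [|rewrite Hs]; field; nra.
- apply is_derive_ext with (fun x => atan_remainder N x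
    - (x ^ (3 * S N + 1) / (3 * INR (S N) + 1)
       - x ^ (3 * S N + 2) / (3 * INR (S N) + 2))).
  { intros t; unfold atan_remainder; rewrite sum_Sn; unfold plus; simpl; ring. }
  replace (x ^ (3 * S N + 3) / (1 + x + x ^ 2))
    with (x ^ (3 * N + 3) / (1 + x + x ^ 2) - x ^ (3 * S N) * (1 - x)).
  + apply @is_derive_minus; [exact IH | apply Hterm].
  + replace (3 * S N)%nat with (3 * N + 3)%nat by lia.
    rewrite (pow_add x (3 * N + 3) 3); field; lra.
Qed.

Lemma atan_remainder_ends (N : nat) :
  atan_remainder N 1 - atan_remainder N 0
  = PI / (3 * sqrt 3)
    - sum_n (fun n => 1 / (3 * INR n + 1) - 1 / (3 * INR n + 2)) N.
Proof.
assert (Hs : sqrt 3 * sqrt 3 = 3) by (apply sqrt_sqrt; lra).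
assert (Hs0 : 0 < sqrt 3) by (apply sqrt_lt_R0; lra).
unfold atan_remainder.
replace ((2 * 1 + 1) / sqrt 3) with (sqrt 3)
  by (transitivity (sqrt 3 * sqrt 3 / sqrt 3);
      [field; lra | rewrite Hs; f_equal; ring]).
replace ((2 * 0 + 1) / sqrt 3) with (1 / sqrt 3) by (field; lra).
(* The two arctangents are PI/3 and PI/6. *)
assert (Hat : 2 / sqrt 3 * atan (sqrt 3) - 2 / sqrt 3 * atan (1 / sqrt 3)
  = PI / (3 * sqrt 3)).
{ pose proof PI_RGT_0.
  rewrite <- tan_PI6.
  replace (atan (sqrt 3)) with (PI / 3) by (rewrite <- tan_PI3, atan_tan; lra).
  rewrite atan_tan by lra; field; lra. }
rewrite <- Hat.
rewrite (sum_n_ext (fun n => 1 ^ (3 * n + 1) / (3 * INR n + 1)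
                    - 1 ^ (3 * n + 2) / (3 * INR n + 2))
  (fun n => 1 / (3 * INR n + 1) - 1 / (3 * INR n + 2)))
  by (intros n; rewrite !pow1; reflexivity).
rewrite (sum_n_ext (fun n => 0 ^ (3 * n + 1) / (3 * INR n + 1)
                    - 0 ^ (3 * n + 2) / (3 * INR n + 2)) (fun _ => 0)).
2:{ intros n; rewrite !pow_i by lia.
    change (0 / (3 * INR n + 1) - 0 / (3 * INR n + 2) = 0 :> R).
    unfold Rdiv; ring. }
rewrite sum_n_const; ring.
Qed.

(** On [0,1] the derivative lies between 0 and x^(3N+3), whose integral is 1/(3N+4). *)
Lemma atan_remainder_bound (N : nat) :
  0 <= atan_remainder N 1 - atan_remainder N 0 <= 1 / (INR N + 1).
Proof.
pose proof (pos_INR N).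
assert (Hquot : forall x, 0 <= x <= 1 ->
  0 <= x ^ (3 * N + 3) / (1 + x + x ^ 2) <= x ^ (3 * N + 3)).
{ intros x Hx.
  assert (0 <= x ^ (3 * N + 3)) by (apply pow_le; lra).
  split; [apply Rle_div_r | apply Rle_div_l]; nra. }
split.
- pose proof (nonneg_derivative_le (atan_remainder N) _
    (fun x _ => is_derive_atan_remainder N x)
    (fun x Hx => proj1 (Hquot x Hx))); lra.
(* The upper bound is monotonicity of x^(3N+4)/(3N+4) minus the remainder. *)
- pose proof (nonneg_derivative_le
    (fun x => x ^ (3 * N + 4) / (3 * INR N + 4) - atan_remainder N x)
    (fun x => x ^ (3 * N + 3) - x ^ (3 * N + 3) / (1 + x + x ^ 2))) as Hle.
  cbv beta in Hle; rewrite pow1, pow_i in Hle by lia.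
  assert (1 / (3 * INR N + 4) <= 1 / (INR N + 1)).
  { apply Rmult_le_compat_l; [lra|]; apply Rinv_le_contravar; lra. }
  cut (0 / (3 * INR N + 4) - atan_remainder N 0
       <= 1 / (3 * INR N + 4) - atan_remainder N 1).
  { unfold Rdiv at 1; rewrite Rmult_0_l; lra. }
  apply Hle; intros x Hx; [|specialize (Hquot x Hx); lra].
  apply @is_derive_minus; [|apply is_derive_atan_remainder].
  auto_derive; [exact I|].
  change (N + (N + (N + 0)))%nat with (3 * N)%nat.
  replace (Init.Nat.pred (3 * N + 4)) with (3 * N + 3)%nat by lia.
  rewrite plus_INR, mult_INR; simpl (INR 3); simpl (INR 4); field; lra.
Qed.

(** * Passage to the limit *)

(** A squeeze that serves twice: for the arctangent remainder with C = 1 and for the WZ square with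
    C = 10. *)
Lemma is_lim_seq_close (u v : nat -> R) (C l : R) :
  (forall n, Rabs (u n - v n) <= C / (INR n + 1)) ->
  is_lim_seq v l -> is_lim_seq u l.
Proof.
intros Hclose Hv.
assert (Hinv : is_lim_seq (fun n => C / (INR n + 1)) 0).
{ replace (Finite 0) with (Rbar_mult C (Rbar_inv p_infty))
    by (simpl; f_equal; ring).
  apply is_lim_seq_scal_l.
  apply is_lim_seq_inv; [|discriminate].
  apply is_lim_seq_ext with (fun n => INR (S n)); [intros n; apply S_INR|].
  apply (is_lim_seq_incr_1 INR), is_lim_seq_INR. }
assert (Hdiff : is_lim_seq (fun n => u n - v n) 0).
{ apply is_lim_seq_abs_0.
  apply is_lim_seq_le_le with (fun _ => 0) (fun n => C / (INR n + 1));
    [|apply is_lim_seq_const|exact Hinv].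
  intros n; split; [apply Rabs_pos|apply Hclose]. }
apply is_lim_seq_ext with (fun n => (u n - v n) + v n); [intros n; ring|].
replace l with (0 + l) by ring.
now apply is_lim_seq_plus'.
Qed.

Lemma is_series_wz_F_0 : is_series (fun n => wz_F n 0) (2 * PI / sqrt 3).
Proof.
apply is_series_ext with
  (fun n => 6 * (1 / (3 * INR n + 1) - 1 / (3 * INR n + 2)));
  [intros n; symmetry; apply wz_F_0_r|].
assert (Hs0 : 0 < sqrt 3) by (apply sqrt_lt_R0; lra).
replace (2 * PI / sqrt 3) with (6 * (PI / (3 * sqrt 3))) by (field; lra).
apply (@is_series_scal_l R_AbsRing R_NormedModule 6).
apply is_lim_seq_close with (fun _ => PI / (3 * sqrt 3)) 1;
  [|apply is_lim_seq_const].
intros N.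
pose proof (atan_remainder_bound N) as Hb; rewrite atan_remainder_ends in Hb.
apply Rabs_le.
set (s := sum_n _ N) in *; lra.
Qed.

Theorem mainTheorem13 :
  is_series
    (fun k : nat =>
       (1 / 4) ^ k
       * (pochhammer (1 / 3) k / pochhammer (7 / 6) k)
       * ((9 * INR k + 7) / ((INR k + 1) * (3 * INR k + 2))))
    (2 * PI / sqrt 3).
Proof.
apply is_series_ext with (wz_G 0); [exact wz_G_0_l|].
(* [is_series] unfolds to convergence of the partial sums [sum_n], so both arguments fit without
   conversion lemmas. *)
exact (is_lim_seq_close _ _ _ _ wz_sums_close is_series_wz_F_0).
Qed.
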